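(* Let $\mathcal{C}$ and $\mathcal{D}$ be abelian categories, with $\mathcal{D}$ having enough projectives, and let $Q$ be a projective object of $\mathcal{C}$. Let $F:\mathcal{C}\to\mathcal{D}$ be an additive functor admitting a right adjoint $G:\mathcal{D}\to\mathcal{C}$. Then there is an isomorphism of functors on $\mathcal{D}$ $$h^Q\circ\underline{G}\simeq\underline{h}^{F(Q)} ,$$ i.e. $\mathrm{Hom}_{\mathcal{C}}(Q,\underline{G}(A))\simeq\underline{\mathrm{Hom}}_{\mathcal{D}}(F(Q),A)$ naturally in $A\in\mathcal{D}$.
   Context: $h^Q=\mathrm{Hom}_{\mathcal{C}}(Q,-)$. The quot-stabilization (projective stabilization) $\underline{G}$ of $G$ is given by $\underline{G}(A)=\mathrm{Coker}(G(P)\to G(A))$ for any epimorphism $P\to A$ in $\mathcal{D}$ with $P$ projective; this is independent of the choice and functorial in $A$. $\underline{h}^{X}=\underline{\mathrm{Hom}}_{\mathcal{D}}(X,-)$ denotes Hom modulo projectives: the quotient of $\mathrm{Hom}_{\mathcal{D}}(X,-)$ by the subgroup of morphisms factoring through a projective object. *)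

(* Defs.v *)
From HB Require Import structures.
From mathcomp Require Import all_boot all_algebra.
From mathcomp Require Import boolp.

Set Implicit Arguments.
Unset Strict Implicit.
Unset Printing Implicit Defensive.

Import GRing.Theory.
Local Open Scope ring_scope.
Local Open Scope quotient_scope.

Record category := Category {
  obj :> Type;
  hom : obj -> obj -> Type;
  idm : forall A, hom A A;
  comp : forall A B C, hom B C -> hom A B -> hom A C;
  comp1m : forall A B (f : hom A B), comp (idm B) f = f;
  compm1 : forall A B (f : hom A B), comp f (idm A) = f;
  compA : forall A B C D (h : hom C D) (g : hom B C) (f : hom A B),
    comp h (comp g f) = comp (comp h g) f }.

Arguments hom {c} A B.
Arguments idm {c} A.
Arguments comp {c A B C} g f.

Notation "g '\c' f" := (comp g f) (at level 40, left associativity).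

Definition is_mono (C : category) (A B : C) (f : hom A B) : Prop :=
  forall (T : C) (g h : hom T A), f \c g = f \c h -> g = h.

Definition is_epi (C : category) (A B : C) (f : hom A B) : Prop :=
  forall (T : C) (g h : hom B T), g \c f = h \c f -> g = h.

Definition is_iso (C : category) (A B : C) (f : hom A B) : Prop :=
  exists g : hom B A, g \c f = idm A /\ f \c g = idm B.

Definition projective (C : category) (P : C) : Prop :=
  forall (A B : C) (e : hom A B) (f : hom P B), is_epi e ->
  exists g : hom P A, e \c g = f.

Definition enough_projectives (C : category) : Prop :=
  forall A : C, exists (P : C) (p : hom P A), projective P /\ is_epi p.

Record functor (C D : category) := Functor {
  fobj :> C -> D;
  fmap : forall A B, hom A B -> hom (fobj A) (fobj B);
  fmap1 : forall A, fmap (idm A) = idm (fobj A);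
  fmapM : forall A B E (g : hom B E) (f : hom A B),
    fmap (g \c f) = fmap g \c fmap f }.

Arguments fmap {C D} F {A B} f : rename.

Section FunctorComp.
Variables (C D E : category) (G : functor D E) (F : functor C D).

Let map A B (f : hom A B) : hom (G (F A)) (G (F B)) := fmap G (fmap F f).

Fact functor_comp1 A : map (idm A) = idm (G (F A)).
Proof. by rewrite /map !fmap1. Qed.

Fact functor_compM A B X (g : hom B X) (f : hom A B) :
  map (g \c f) = map g \c map f.
Proof. by rewrite /map !fmapM. Qed.

Definition functor_comp : functor C E :=
  @Functor C E (fun A => G (F A)) map functor_comp1 functor_compM.
End FunctorComp.

Definition natural (C D : category) (F G : functor C D)
    (eta : forall A : C, hom (F A) (G A)) : Prop :=
  forall (A B : C) (f : hom A B), fmap G f \c eta A = eta B \c fmap F f.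

Definition naturally_isomorphic (C D : category) (F G : functor C D) : Prop :=
  exists eta : forall A : C, hom (F A) (G A),
    natural eta /\ forall A, is_iso (eta A).

Record adjunction (C D : category) (F : functor C D) (G : functor D C) :=
  Adjunction {
    adj : forall (X : C) (A : D), hom (F X) A -> hom X (G A);
    adj_bij : forall X A, bijective (@adj X A);
    adj_natl : forall X Y A (u : hom Y X) (f : hom (F X) A),
      adj (f \c fmap F u) = adj f \c u;
    adj_natr : forall X A B (v : hom A B) (f : hom (F X) A),
      adj (v \c f) = fmap G v \c adj f }.

(* The group structures on the hom sets come first, without any law relating
   them to composition, so that bilinearity can be stated with the notations of
   zmodType. The choice operator included in zmodType is no restriction, since
   it exists classically on every type. *)
Record homgroup_category := HomgroupCategory {
  hg_category :> category;
  hom_zmodule : forall A B : hg_category, GRing.Zmodule (hom A B) }.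

HB.instance Definition _ (C : homgroup_category) (A B : C) := hom_zmodule A B.

Record preadditive := Preadditive {
  pre_category :> homgroup_category;
  compDl : forall (A B C : pre_category) (g h : hom B C) (f : hom A B),
    (g + h) \c f = g \c f + h \c f;
  compDr : forall (A B C : pre_category) (g : hom B C) (f h : hom A B),
    g \c (f + h) = g \c f + g \c h }.

Section PreadditiveTheory.
Variable C : preadditive.
Implicit Types A B X : C.

Lemma comp0m A B X (f : hom A B) : (0 : hom B X) \c f = 0.
Proof. by apply: (addrI (0 \c f)); rewrite -compDl !addr0. Qed.

Lemma compm0 A B X (g : hom B X) : g \c (0 : hom A B) = 0.
Proof. by apply: (addrI (g \c 0)); rewrite -compDr !addr0. Qed.

Lemma compNm A B X (g : hom B X) (f : hom A B) : (- g) \c f = - (g \c f).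
Proof. by apply/eqP; rewrite -addr_eq0 -compDl addNr comp0m. Qed.

Lemma compmN A B X (g : hom B X) (f : hom A B) : g \c (- f) = - (g \c f).
Proof. by apply/eqP; rewrite -addr_eq0 -compDr addNr compm0. Qed.

Lemma compBl A B X (g h : hom B X) (f : hom A B) :
  (g - h) \c f = g \c f - h \c f.
Proof. by rewrite compDl compNm. Qed.

Lemma compBr A B X (g : hom B X) (f h : hom A B) :
  g \c (f - h) = g \c f - g \c h.
Proof. by rewrite compDr compmN. Qed.

(* In a preadditive category, id_Z = 0 iff Z is both initial and terminal. *)
Definition is_zero_object (Z : C) : Prop := idm Z = 0.

Definition is_kernel A B K (f : hom A B) (k : hom K A) : Prop :=
  f \c k = 0 /\
  forall X (g : hom X A), f \c g = 0 -> exists! u : hom X K, k \c u = g.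

Definition is_cokernel A B K (f : hom A B) (c : hom B K) : Prop :=
  c \c f = 0 /\
  forall X (g : hom B X), g \c f = 0 -> exists! u : hom K X, u \c c = g.

Definition is_biproduct A B S (i1 : hom A S) (i2 : hom B S)
    (p1 : hom S A) (p2 : hom S B) : Prop :=
  [/\ p1 \c i1 = idm A, p2 \c i2 = idm B, p1 \c i2 = 0, p2 \c i1 = 0
    & i1 \c p1 + i2 \c p2 = idm S].

(* Mac Lane, Categories for the Working Mathematician, VIII.3 *)
Definition is_abelian : Prop :=
  [/\ exists Z : C, is_zero_object Z,
      forall A B, exists S (i1 : hom A S) (i2 : hom B S) p1 p2,
        is_biproduct i1 i2 p1 p2,
      forall A B (f : hom A B),
        (exists K (k : hom K A), is_kernel f k) /\
        (exists K (c : hom B K), is_cokernel f c),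
      forall A B (m : hom A B), is_mono m ->
        exists X (f : hom B X), is_kernel f m
    & forall A B (e : hom A B), is_epi e ->
        exists X (f : hom X A), is_cokernel f e].

End PreadditiveTheory.

Record abelian := Abelian {
  ab_preadditive :> preadditive;
  abelianP : is_abelian ab_preadditive }.

Definition additive_functor (C D : preadditive) (F : functor C D) : Prop :=
  forall (A B : C) (f g : hom A B), fmap F (f + g) = fmap F f + fmap F g.

Lemma additive_eq (U V : zmodType) (f g : {additive U -> V}) : f =1 g -> f = g.
Proof.
case: f g => [f [[f0]]] [g [[g0]]] /= /funext fg; subst g.
by congr (GRing.Additive.Pack (GRing.Additive.Class _)); congr (_ _).
Qed.

Section Ab.
Implicit Types U V W : zmodType.

Let ab_id U : {additive U -> U} := idfun.
Let ab_comp U V W (g : {additive V -> W}) (f : {additive U -> V}) :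
  {additive U -> W} := g \o f.

Fact ab_comp1m U V (f : {additive U -> V}) : ab_comp (ab_id V) f = f.
Proof. exact: additive_eq. Qed.

Fact ab_compm1 U V (f : {additive U -> V}) : ab_comp f (ab_id U) = f.
Proof. exact: additive_eq. Qed.

Fact ab_compA U V W (T : zmodType) (h : {additive W -> T}) (g : {additive V -> W})
  (f : {additive U -> V}) : ab_comp h (ab_comp g f) = ab_comp (ab_comp h g) f.
Proof. exact: additive_eq. Qed.

Definition Ab : category := @Category zmodType
  (fun U V => {additive U -> V}) ab_id ab_comp ab_comp1m ab_compm1 ab_compA.
End Ab.

Section HomFunctor.
Variables (C : preadditive) (X : C).

Definition postcomp A B (f : hom A B) (u : hom X A) : hom X B := f \c u.

Fact postcompB A B (f : hom A B) : zmod_morphism (postcomp f).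
Proof. by move=> u v; rewrite /postcomp compBr. Qed.

HB.instance Definition _ A B (f : hom A B) :=
  GRing.isZmodMorphism.Build (hom X A) (hom X B) (postcomp f) (postcompB f).

Let homF (A : C) : Ab := hom X A : zmodType.
Let hom_map A B (f : hom A B) : hom (homF A) (homF B) :=
  postcomp f : {additive _ -> _}.

Fact hom_functor1 A : hom_map (idm A) = idm (homF A).
Proof. by apply: additive_eq => u; apply: comp1m. Qed.

Fact hom_functorM A B E (g : hom B E) (f : hom A B) :
  hom_map (g \c f) = hom_map g \c hom_map f.
Proof. by apply: additive_eq => u /=; rewrite /postcomp compA. Qed.

Definition hom_functor : functor C Ab :=
  @Functor C Ab homF hom_map hom_functor1 hom_functorM.
End HomFunctor.

Definition factors_through_projective (C : category) (X A : C)
    (f : hom X A) : Prop :=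
  exists (P : C) (g : hom X P) (h : hom P A), projective P /\ f = h \c g.

Section StableHom.
Variable D : abelian.
Implicit Types X A B P : D.

Definition proj_homs X A : {pred hom X A} :=
  fun f => `[< factors_through_projective f >].

Lemma projective_zero (Z : D) : is_zero_object Z -> projective Z.
Proof.
move=> Z0 A B e f _; exists 0.
by rewrite compm0 -[f]compm1 Z0 compm0.
Qed.

Lemma projective_biproduct (P1 P2 S : D) (i1 : hom P1 S) (i2 : hom P2 S) p1 p2 :
  is_biproduct i1 i2 p1 p2 -> projective P1 -> projective P2 -> projective S.
Proof.
case=> _ _ _ _ idS pr1 pr2 A B e f epi_e.
have [g1 eg1] := pr1 _ _ e (f \c i1) epi_e.
have [g2 eg2] := pr2 _ _ e (f \c i2) epi_e.
exists (g1 \c p1 + g2 \c p2).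
by rewrite compDr !compA eg1 eg2 -!compA -compDr idS compm1.
Qed.

Fact proj_homs_zmod_closed X A : zmod_closed (@proj_homs X A).
Proof.
have [[Z Z0] biprod _ _ _] := abelianP D.
split=> [|f1 f2 /asboolP[P1 [g1 [h1 [pr1 ->]]]] /asboolP[P2 [g2 [h2 [pr2 ->]]]]].
  apply/asboolP; exists Z, 0, 0; split; first exact: projective_zero.
  by rewrite comp0m.
have [S [i1 [i2 [p1 [p2 S12]]]]] := biprod P1 P2.
apply/asboolP; exists S, (i1 \c g1 - i2 \c g2), (h1 \c p1 + h2 \c p2).
split; first exact: projective_biproduct S12 pr1 pr2.
have [p1i1 p2i2 p1i2 p2i1 _] := S12.
rewrite compDl !compBr !compA -!(compA h1) -!(compA h2) p1i1 p2i2 p1i2 p2i1.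
by rewrite !comp1m !comp0m !compm0 subr0 sub0r.
Qed.

HB.instance Definition _ X A := GRing.isZmodClosed.Build (hom X A)
  (@proj_homs X A) (@proj_homs_zmod_closed X A).

Definition stable_hom X A : zmodType := Quotient.quot (@proj_homs X A).

(* The type ascription of the quotient is spelled out because the quotient
   structure is not visible through the zmodType stable_hom X A. *)
Definition stable_class X A (f : hom X A) : stable_hom X A :=
  \pi_(Quotient.quot (@proj_homs X A)) f.

Lemma stable_class_eq X A (f g : hom X A) :
  stable_class f = stable_class g <-> factors_through_projective (f - g).
Proof.
split=> [/eqP|fg]; first by rewrite -Quotient.idealrBE => /asboolP.
by apply/eqP; rewrite -Quotient.idealrBE; apply/asboolP.
Qed.

Lemma stable_classB X A : zmod_morphism (@stable_class X A).
Proof. by move=> f g; rewrite /stable_class raddfB. Qed.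

Lemma stable_classP X A (u : stable_hom X A) : exists f, stable_class f = u.
Proof. by exists (repr u); apply: reprK. Qed.

Variable X : D.

Definition stable_postcomp A B (f : hom A B) (u : stable_hom X A) :
  stable_hom X B := stable_class (f \c repr u).

Lemma stable_postcompE A B (f : hom A B) (u : hom X A) :
  stable_postcomp f (stable_class u) = stable_class (f \c u).
Proof.
rewrite /stable_postcomp; apply/stable_class_eq; rewrite -compBr.
have /stable_class_eq[P [g [h [prP ->]]]] :
  stable_class (repr (stable_class u)) = stable_class u by apply: reprK.
by exists P, g, (f \c h); split; last exact: compA.
Qed.

Fact stable_postcompB A B (f : hom A B) : zmod_morphism (stable_postcomp f).
Proof.
move=> u v; have [[u0 <-] [v0 <-]] := (stable_classP u, stable_classP v).
by rewrite -stable_classB !stable_postcompE compBr stable_classB.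
Qed.

HB.instance Definition _ A B (f : hom A B) :=
  GRing.isZmodMorphism.Build (stable_hom X A) (stable_hom X B)
    (stable_postcomp f) (stable_postcompB f).

Let shomF (A : D) : Ab := stable_hom X A.
Let shom_map A B (f : hom A B) : hom (shomF A) (shomF B) :=
  stable_postcomp f : {additive _ -> _}.

Fact stable_hom_functor1 A : shom_map (idm A) = idm (shomF A).
Proof.
apply: additive_eq => u; have [u0 <-] := stable_classP u.
by rewrite /= stable_postcompE comp1m.
Qed.

Fact stable_hom_functorM A B E (g : hom B E) (f : hom A B) :
  shom_map (g \c f) = shom_map g \c shom_map f.
Proof.
apply: additive_eq => u; have [u0 <-] := stable_classP u.
by rewrite /= !stable_postcompE compA.
Qed.

Definition stable_hom_functor : functor D Ab :=
  @Functor D Ab shomF shom_map stable_hom_functor1 stable_hom_functorM.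
End StableHom.

Section QuotStabilization.
Variables (C D : abelian) (epD : enough_projectives D) (G : functor D C).
Implicit Types A B P : D.

Lemma cokernelP (A B : C) (f : hom A B) :
  exists K (c : hom B K), is_cokernel f c.
Proof. by have [_ _ /(_ A B f)[]] := abelianP C. Qed.

(* For each A, an arbitrary epimorphism from a projective object onto A and an
   arbitrary cokernel are chosen; quot_stab_cokerP below shows that the result
   is a cokernel for every projective presentation of A. *)
Definition proj_pres A : D := projT1 (cid (epD A)).

Definition proj_pres_map A : hom (proj_pres A) A :=
  projT1 (cid (projT2 (cid (epD A)))).

Lemma proj_presP A : projective (proj_pres A).
Proof. by have [] := projT2 (cid (projT2 (cid (epD A)))). Qed.

Lemma proj_pres_epi A : is_epi (proj_pres_map A).
Proof. by have [] := projT2 (cid (projT2 (cid (epD A)))). Qed.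

Definition quot_stab A : C :=
  projT1 (cid (cokernelP (fmap G (proj_pres_map A)))).

Definition quot_stab_proj A : hom (G A) (quot_stab A) :=
  projT1 (cid (projT2 (cid (cokernelP (fmap G (proj_pres_map A)))))).

Lemma quot_stab_coker A :
  is_cokernel (fmap G (proj_pres_map A)) (quot_stab_proj A).
Proof. exact: projT2 (cid (projT2 (cid _))). Qed.

Lemma quot_stab_cokerP A P (p : hom P A) :
  projective P -> is_epi p -> is_cokernel (fmap G p) (quot_stab_proj A).
Proof.
move=> prP epi_p; have [c0 cU] := quot_stab_coker A; split.
  have [g <-] := prP _ _ _ p (@proj_pres_epi A).
  by rewrite fmapM compA c0 comp0m.
move=> T g gp0; apply: cU.
have [h <-] := proj_presP (proj_pres_map A) epi_p.
by rewrite fmapM compA gp0 comp0m.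
Qed.

Lemma quot_stab_epi A : is_epi (quot_stab_proj A).
Proof.
have [c0 cU] := quot_stab_coker A; move=> T g h gh.
have [|u [_ uU]] := cU _ (h \c quot_stab_proj A).
  by rewrite -compA c0 compm0.
by rewrite -(uU _ gh) -(uU _ erefl).
Qed.

Fact quot_stab_map_subproof A B (f : hom A B) :
  exists u : hom (quot_stab A) (quot_stab B),
    u \c quot_stab_proj A = quot_stab_proj B \c fmap G f.
Proof.
have [c0 cU] := quot_stab_coker A.
have [g fg] := proj_presP (f \c proj_pres_map A) (@proj_pres_epi B).
have [|u [uE _]] := cU _ (quot_stab_proj B \c fmap G f); last by exists u.
rewrite -compA -fmapM -fg fmapM compA.
by have [-> _] := quot_stab_coker B; rewrite comp0m.
Qed.

Definition quot_stab_map A B (f : hom A B) : hom (quot_stab A) (quot_stab B) :=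
  projT1 (cid (quot_stab_map_subproof f)).

Lemma quot_stab_mapE A B (f : hom A B) :
  quot_stab_map f \c quot_stab_proj A = quot_stab_proj B \c fmap G f.
Proof. exact: projT2 (cid (quot_stab_map_subproof f)). Qed.

Fact quot_stab_map1 A : quot_stab_map (idm A) = idm (quot_stab A).
Proof.
by apply: quot_stab_epi; rewrite quot_stab_mapE fmap1 compm1 comp1m.
Qed.

Fact quot_stab_mapM A B E (g : hom B E) (f : hom A B) :
  quot_stab_map (g \c f) = quot_stab_map g \c quot_stab_map f.
Proof.
apply: quot_stab_epi.
by rewrite -compA !quot_stab_mapE fmapM !compA quot_stab_mapE.
Qed.

Definition quot_stabilization : functor D C :=
  @Functor D C quot_stab quot_stab_map quot_stab_map1 quot_stab_mapM.
End QuotStabilization.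

(* Main.v *)
From HB Require Import structures.
From mathcomp Require Import all_boot all_algebra.
From mathcomp Require Import boolp.
Require Import Defs.

Set Implicit Arguments.
Unset Strict Implicit.
Unset Printing Implicit Defensive.

Import GRing.Theory.
Local Open Scope ring_scope.

(** Transposing along the adjunction and projecting onto the cokernel gives a
    homomorphism Hom(F Q, A) -> Hom(Q, quot_stab A).  It is surjective because
    Q is projective.  A morphism f is killed iff its transpose factors through
    the image of G P -> G A, where P -> A is a projective presentation; since Q
    is projective this means that the transpose lifts to G P, i.e. that f
    factors through P, or equivalently through some projective object. *)

Lemma naturally_isomorphic_sym (C D : category) (F G : functor C D) :
  naturally_isomorphic F G -> naturally_isomorphic G F.
Proof.
move=> [eta [nat_eta iso_eta]].
pose inv A : hom (G A) (F A) := sval (cid (iso_eta A)).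
have invP A : inv A \c eta A = idm (F A) /\ eta A \c inv A = idm (G A).
  exact: svalP (cid (iso_eta A)).
exists inv; split=> [A B f | A]; last by exists (eta A); have [] := invP A.
have [[_ invK] [invK' _]] := (invP A, invP B).
by rewrite -[RHS]compm1 -invK compA -(compA (inv B)) nat_eta compA invK' comp1m.
Qed.

Lemma Ab_is_iso (U V : zmodType) (f : {additive U -> V}) :
  bijective f -> @is_iso Ab U V f.
Proof.
case=> g fK gK.
have gB : zmod_morphism g.
  by move=> x y; rewrite -[in LHS](gK x) -[in LHS](gK y) -raddfB fK.
pose gM := GRing.isZmodMorphism.Build V U g gB.
pose g' : {additive V -> U} := HB.pack g gM.
by exists g'; split; apply: additive_eq => x /=; rewrite ?fK ?gK.
Qed.

Lemma kernel_mono (C : preadditive) (A B K : C) (f : hom A B) (k : hom K A) :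
  is_kernel f k -> is_mono k.
Proof.
move=> [fk0 kU] T g h gh.
have [|u [_ uU]] := kU _ (k \c h); first by rewrite compA fk0 comp0m.
by rewrite -(uU _ gh) -(uU _ erefl).
Qed.

Lemma is_mono_comp (C : category) (A B E : C) (g : hom B E) (f : hom A B) :
  is_mono g -> is_mono f -> is_mono (g \c f).
Proof. by move=> mg mf T u v; rewrite -!compA => /mg/mf. Qed.

(** Here [k] is the image of [f]. If [g] and [h] agree after [e], then [f] already factors through
    the subobject [k \c m], with [m] the equalizer of [g] and [h]; minimality of the image then
    gives [m] a right inverse, so [g = h]. *)
Lemma coimage_epi (C : abelian) (A B K L : C) (f : hom A B) (c : hom B L)
    (k : hom K B) (e : hom A K) :
  is_cokernel f c -> is_kernel c k -> k \c e = f -> is_epi e.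
Proof.
move=> [_ cU] kerk ke T g h ge_he.
have [_ _ kers monoK _] := abelianP C.
have mono_k := kernel_mono kerk.
have [[M [m kerm]] _] := kers _ _ (g - h).
have [gm0 mU] := kerm.
have [|e' [me' _]] := mU _ e; first by rewrite compBl ge_he subrr.
(* The subobject km of B is the kernel of some x; as x kills f, it kills k. *)
have [X [x [xkm0 xU]]] := monoK _ _ _ (is_mono_comp mono_k (kernel_mono kerm)).
have [|y [yc _]] := cU _ x.
  by rewrite -ke -me' compA compA -(compA x) xkm0 comp0m.
have [|t [kmt _]] := xU _ k; first by rewrite -yc -compA kerk.1 compm0.
have mt : m \c t = idm K by apply: mono_k; rewrite compm1 compA.
by apply/eqP; rewrite -subr_eq0 -[g - h]compm1 -mt compA gm0 comp0m.
Qed.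

(** A map killed by [c] lands in the image of [f], onto which [A] maps epimorphically, so
    projectivity lifts it to [A]. *)
Lemma projective_exact (C : abelian) (Q A B L : C) (f : hom A B) (c : hom B L)
    (u : hom Q B) :
  projective Q -> is_cokernel f c -> c \c u = 0 ->
  exists v : hom Q A, f \c v = u.
Proof.
move=> prQ cokc cu0; have [_ _ kers _ _] := abelianP C.
have [[K [k kerk]] _] := kers _ _ c; have [_ kU] := kerk.
have [w [kw _]] := kU _ u cu0; have [e [ke _]] := kU _ f cokc.1.
have [v ev] := prQ _ _ e w (coimage_epi cokc kerk ke).
by exists v; rewrite -ke -compA ev.
Qed.

(** The inverse of transposition is [u] ↦ [eps \c fmap F u], with [eps] the counit at [A]; it
    respects differences because [F] does. *)
Lemma adjB (C D : preadditive) (F : functor C D) (G : functor D C)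
    (a : adjunction F G) X A :
  additive_functor F -> zmod_morphism (@adj C D F G a X A).
Proof.
move=> addF f g.
have [adj1 adj1K K1adj] := adj_bij a (G A) A.
pose eps := adj1 (idm (G A)).
have epsE (u : hom X (G A)) : adj a (eps \c fmap F u) = u.
  by rewrite adj_natl K1adj comp1m.
have fE (h : hom (F X) A) : eps \c fmap F (adj a h) = h.
  by apply: (bij_inj (adj_bij a X A)); rewrite epsE.
rewrite -[RHS]epsE; congr (adj a _).
have FB : fmap F (adj a f - adj a g) = fmap F (adj a f) - fmap F (adj a g).
  by apply: (addIr (fmap F (adj a g))); rewrite -addF !subrK.
by rewrite FB compBr !fE.
Qed.

Section Comparison.
Variables (C D : abelian) (epD : enough_projectives D) (Q : C).
Variables (F : functor C D) (G : functor D C).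
Hypotheses (projQ : projective Q) (addF : additive_functor F).
Variable a : adjunction F G.
Implicit Types A B : D.

Let c A : hom (G A) (quot_stab epD G A) := quot_stab_proj epD G A.

Lemma quot_stab_adj_eq0 A (f : hom (F Q) A) :
  c A \c adj a f = 0 <-> factors_through_projective f.
Proof.
split=> [cf0 | [P [g [h [prP ->]]]]].
  have [v vE] := projective_exact projQ (quot_stab_coker epD G A) cf0.
  have [adj1 adjK Kadj] := adj_bij a Q (proj_pres epD A).
  exists (proj_pres epD A), (adj1 v), (proj_pres_map epD A).
  split; first exact: proj_presP.
  by apply: (bij_inj (adj_bij a Q A)); rewrite adj_natr Kadj.
(* Any projective over [A] maps through the chosen presentation, whose image under [G] is killed by
   [c A]. *)
have [k <-] := prP _ _ _ h (@proj_pres_epi D epD A).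
rewrite adj_natr fmapM !compA (quot_stab_coker epD G A).1.
by rewrite !comp0m.
Qed.

Definition stable_adj A (u : stable_hom (F Q) A) : hom Q (quot_stab epD G A) :=
  c A \c adj a (repr u).

Lemma stable_adjE A (f : hom (F Q) A) :
  stable_adj (stable_class f) = c A \c adj a f.
Proof.
apply/eqP; rewrite -subr_eq0 -compBr -(adjB a addF); apply/eqP.
(* The chosen representative differs from [f] by a map factoring through a projective. *)
by apply/quot_stab_adj_eq0/stable_class_eq; apply: reprK.
Qed.

Lemma stable_adjB A : zmod_morphism (@stable_adj A).
Proof.
move=> u v; have [[f <-] [g <-]] := (stable_classP u, stable_classP v).
by rewrite -stable_classB !stable_adjE (adjB a addF) compBr.
Qed.

Lemma stable_adj_bij A : bijective (@stable_adj A).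
Proof.
have surj (w : hom Q (quot_stab epD G A)) : exists u, stable_adj u = w.
  (* Lift [w] along the epimorphism [c A], then transpose back. *)
  have [v vE] := projQ w (@quot_stab_epi _ _ epD G A).
  have [adj1 _ Kadj] := adj_bij a Q A.
  by exists (stable_class (adj1 v)); rewrite stable_adjE Kadj.
have inj : injective (@stable_adj A).
  move=> u v; have [[f <-] [g <-]] := (stable_classP u, stable_classP v).
  rewrite !stable_adjE => fg; apply/stable_class_eq/quot_stab_adj_eq0.
  by rewrite (adjB a addF) compBr fg subrr.
pose inv w := sval (cid (surj w)).
have invK w : stable_adj (inv w) = w := svalP (cid (surj w)).
by exists inv => // u; apply: inj; rewrite invK.
Qed.

End Comparison.

Theorem proposition11p2 (C D : abelian) (epD : enough_projectives D)
    (Q : C) (projQ : projective Q) (F : functor C D) (G : functor D C)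
    (addF : additive_functor F) (adjFG : adjunction F G) :
  naturally_isomorphic
    (functor_comp (hom_functor Q) (quot_stabilization epD G))
    (stable_hom_functor (F Q)).
Proof.
(* The explicit map starts from the stable Hom, where it can be computed on representatives. *)
apply: naturally_isomorphic_sym.
pose eta (A : D) : {additive stable_hom (F Q) A -> hom Q (quot_stab epD G A)} :=
  HB.pack (@stable_adj C D epD Q F G adjFG A)
    (GRing.isZmodMorphism.Build _ _ _ (@stable_adjB C D epD Q F G projQ addF adjFG A)).
exists eta; split=> [A B f | A]; last first.
  exact/Ab_is_iso/stable_adj_bij.
apply: additive_eq => u; have [f0 <-] := stable_classP u.
rewrite /= /postcomp stable_postcompE !stable_adjE // adj_natr.
by rewrite !compA quot_stab_mapE.
Qed.
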